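(* Let $A\in\mathbb R^{n_x\times n_x}$, $B\in\mathbb R^{n_x\times n_u}$, $C\in\mathbb R^{n_y\times n_x}$ and consider the plant $${}^{s}\Sigma:\ x(t+1)=Ax(t)+Bu(t)+w(t),\quad y(t)=Cx(t)+v(t),\quad t\ge0,\ x(0)=0 .$$ Let $L\in\mathbb N$ and suppose ${}^{s}\Sigma$ is $L$-step observable, i.e. $\operatorname{rank}\mathcal O_L(A,C)=n_x$. Consider the system $$\Sigma:\ h(t+1)=\Theta h(t)+\Pi_dd(t)+\Pi_uu(t),\quad y(t)=\Psi h(t)+\Upsilon d(t),\quad z(t)=\Gamma h(t),\quad t\ge L,$$ where $d(t)=[w(t)^\top,v(t)^\top]^\top$ and the matrices $\Theta,\Pi_d,\Pi_u,\Psi,\Upsilon,\Gamma$ are those given in the context. If the initial state $h(L)$ of $\Sigma$ coincides with the history of $\{u,y,w,v\}$ for $t\in\{0,\dots,L-1\}$, i.e. $h(L)=[([u]_0^{L-1})^\top,([y]_0^{L-1})^\top,([w]_0^{L-1})^\top,([v]_0^{L-1})^\top]^\top$, then ${}^{s}\Sigma$ and $\Sigma$ are equivalent in the sense that, for any input sequences $\{u,w,v\}$, the outputs $y$ generated by ${}^{s}\Sigma$ and by $\Sigma$ coincide for each $t\ge L$.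
   Context: Dimensions: $x\in\mathbb R^{n_x}$, $u\in\mathbb R^{n_u}$, $y\in\mathbb R^{n_y}$, $w\in\mathbb R^{n_w}$, $v\in\mathbb R^{n_v}$, with $n_w=n_x$, $n_v=n_y$. Notation: $[x]_{t_1}^{t_2}:=[x(t_1)^\top,\dots,x(t_2)^\top]^\top$; $\mathcal R_L(A,B):=[A^{L-1}B,\dots,AB,B]$; $\mathcal O_L(A,C):=[C^\top,(CA)^\top,\dots,(CA^{L-1})^\top]^\top$; $\mathcal H_L(A,B,C)$ is the $L\times L$ block matrix with $(i,j)$ block $0$ if $i\le j$ and $CA^{i-j-1}B$ if $i>j$; $\dagger$ is the Moore–Penrose inverse. Histories associated with trajectories of ${}^{s}\Sigma$, for $t\ge L$: $z(t):=[([u]_{t-L}^{t-1})^\top,([y]_{t-L}^{t-1})^\top]^\top\in\mathbb R^{n_z}$, $n_z=L(n_u+n_y)$; $e(t):=[([w]_{t-L}^{t-1})^\top,([v]_{t-L}^{t-1})^\top]^\top\in\mathbb R^{n_e}$, $n_e=L(n_w+n_v)$; $h(t):=[z(t)^\top,e(t)^\top]^\top\in\mathbb R^{n_z+n_e}$. Matrices: $J_n\in\mathbb R^{Ln\times Ln}$ is the block shift with $I_n$ on the first block superdiagonal and zeros elsewhere; $E_n=[0,\dots,0,I_n]^\top\in\mathbb R^{Ln\times n}$. In the block partition of sizes $Ln_u,Ln_y,Ln_w,Ln_v$, $$\Theta=\mathrm{diag}(J_{n_u},J_{n_y},J_{n_w},J_{n_v})+\begin{bmatrix} 0 \\ E_{n_y}C[M_1\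 M_2\ M_3\ M_4] \\ 0 \\ 0 \end{bmatrix},\quad \Pi_d=\begin{bmatrix} 0 & 0 \\ 0 & E_{n_y} \\ E_{n_w} & 0 \\ 0 & E_{n_v} \end{bmatrix},\quad \Pi_u=\begin{bmatrix} E_{n_u} \\ 0 \\ 0 \\ 0 \end{bmatrix},$$ $\Psi=C[M_1,M_2,M_3,M_4]$, $\Gamma=[I_{n_z},0]$, $\Upsilon=[0,I_{n_y}]$, where $M_1=\mathcal R_L(A,B)-A^L\mathcal O_L^\dagger(A,C)\mathcal H_L(A,B,C)$, $M_2=A^L\mathcal O_L^\dagger(A,C)$, $M_3=\mathcal R_L(A,I)-A^L\mathcal O_L^\dagger(A,C)\mathcal H_L(A,I,C)$, $M_4=-A^L\mathcal O_L^\dagger(A,C)$. *)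

(* Defs.v *)
(* World: MathComp / MathComp-Analysis. *)
From mathcomp Require Import all_boot all_order all_algebra.
From mathcomp Require Import boolp classical_sets reals.
Set Implicit Arguments.
Unset Strict Implicit.
Unset Printing Implicit Defensive.
Import Order.TTheory GRing.Theory Num.Theory.
Local Open Scope ring_scope.

Definition is_mpinv (R : realType) (m n : nat)
    (A : 'M[R]_(m, n)) (X : 'M[R]_(n, m)) : Prop :=
  [/\ A *m X *m A = A,
      X *m A *m X = X,
      (A *m X)^T = A *m X
    & (X *m A)^T = X *m A].

Lemma is_mpinv_uniq (R : realType) (m n : nat)
    (A : 'M[R]_(m, n)) (X Y : 'M[R]_(n, m)) :
  is_mpinv A X -> is_mpinv A Y -> X = Y.
Proof.
move=> [X1 X2 X3 X4] [Y1 Y2 Y3 Y4].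
have eAX : A *m X = A *m Y.
  rewrite -X3 -{1}Y1 -!mulmxA mulmxA trmx_mul X3 Y3.
  by rewrite mulmxA X1.
have eXA : X *m A = Y *m A.
  rewrite -X4 -{1}Y1 -mulmxA mulmxA trmx_mul Y4 X4.
  by rewrite -mulmxA (mulmxA A) X1.
by rewrite -X2 eXA -mulmxA eAX mulmxA Y2.
Qed.

Lemma row_free_gram (R : realType) (m n : nat) (A : 'M[R]_(m, n)) :
  row_free A -> A *m A^T \in unitmx.
Proof.
move=> fA; rewrite -row_free_unit; apply/row_freeP.
apply/row_freeP; rewrite -kermx_eq0; apply/eqP/row_matrixP => i.
rewrite row0; set x := row i _.
have x0 : x *m (A *m A^T) = 0 by rewrite /x -row_mul mulmx_ker row0.
have xA : x *m A = 0.
  have: (x *m A) *m (x *m A)^T = 0.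
    by rewrite trmx_mul mulmxA -(mulmxA x) x0 mul0mx.
  move: (x *m A) => y /matrixP /(_ 0 0); rewrite !mxE => /eqP.
  rewrite psumr_eq0 => [/allP y0|j _]; last by rewrite mxE -expr2 sqr_ge0.
  apply/matrixP => i' j; rewrite (ord1 i') [RHS]mxE.
  by have := y0 j (mem_index_enum _); rewrite mxE -expr2 sqrf_eq0 => /eqP.
by apply: (row_free_inj fA); rewrite /= mul0mx.
Qed.

Lemma is_mpinv_ex (R : realType) (m n : nat) (A : 'M[R]_(m, n)) :
  exists X, is_mpinv A X.
Proof.
suff gen r (F : 'M[R]_(m, r)) (G : 'M[R]_(r, n)) :
    row_free F^T -> row_free G -> exists X, is_mpinv (F *m G) X.
  rewrite -(mulmx_base A); apply: gen; last exact: row_base_free.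
  by rewrite /row_free mxrank_tr; exact: col_base_full.
move=> /row_free_gram; rewrite trmxK => uF /row_free_gram uG.
pose Gi := G^T *m invmx (G *m G^T).
pose Fi := invmx (F^T *m F) *m F^T.
have GGi : G *m Gi = 1%:M by rewrite mulmxA mulmxV.
have FiF : Fi *m F = 1%:M by rewrite -mulmxA mulVmx.
have AX : F *m G *m (Gi *m Fi) = F *m Fi.
  by rewrite -mulmxA (mulmxA G) GGi mul1mx.
have XA : Gi *m Fi *m (F *m G) = Gi *m G.
  by rewrite -mulmxA (mulmxA Fi) FiF mul1mx.
exists (Gi *m Fi); split.
- by rewrite AX -mulmxA (mulmxA Fi) FiF mul1mx.
- by rewrite XA -mulmxA (mulmxA G) GGi mul1mx.
- by rewrite AX /Fi !trmx_mul trmxK trmx_inv trmx_mul trmxK mulmxA.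
- by rewrite XA /Gi !trmx_mul trmxK trmx_inv trmx_mul trmxK mulmxA.
Qed.

(* Moore-Penrose inverse: the X singled out by is_mpinv_ex and is_mpinv_uniq.
   It differs in general from the library's pinvmx, which is not required to
   satisfy the two symmetry conditions. *)
Definition mpinv (R : realType) (m n : nat) (A : 'M[R]_(m, n)) : 'M[R]_(n, m) :=
  xget 0 [set X | is_mpinv A X]%classic.

Lemma mpinvP (R : realType) (m n : nat) (A : 'M[R]_(m, n)) :
  is_mpinv A (mpinv A).
Proof. by have [X AX] := is_mpinv_ex A; exact: (xgetI (x := X) 0 AX). Qed.

(* The dimension L * n, in the form used by the library for matrices made of
   L blocks of size n. *)
Notation bdim L n := (\sum_(i < L) n)%N.

(* stack f t L is the vector [f]_t^(t + L - 1) of L consecutive samples. *)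
Definition stack (R : realType) (n : nat) (f : nat -> 'cV[R]_n) (t L : nat) :
    'cV[R]_(bdim L n) :=
  \mxcol_(i < L) f (t + i)%N.

(* Block indices start at 0, so the j-th block of reachmx is A^(L-1-j) B and the
   (i, j) block of toepmx, for i > j, is C A^(i-j-1) B. *)
Definition reachmx (R : realType) (nx m L : nat)
    (A : 'M[R]_nx) (B : 'M[R]_(nx, m)) : 'M[R]_(nx, bdim L m) :=
  \mxrow_(j < L) (A ^+ (L - j.+1) *m B).

Definition obsmx (R : realType) (nx ny L : nat)
    (A : 'M[R]_nx) (C : 'M[R]_(ny, nx)) : 'M[R]_(bdim L ny, nx) :=
  \mxcol_(i < L) (C *m A ^+ i).

Definition toepmx (R : realType) (nx m ny L : nat)
    (A : 'M[R]_nx) (B : 'M[R]_(nx, m)) (C : 'M[R]_(ny, nx)) :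
    'M[R]_(bdim L ny, bdim L m) :=
  \mxblock_(i < L, j < L)
    (if (j < i)%N then C *m A ^+ (i - j.+1) *m B else 0).

Definition shiftmx (R : realType) (L n : nat) : 'M[R]_(bdim L n) :=
  \mxblock_(i < L, j < L) (if j == i.+1 :> nat then 1%:M else 0 : 'M[R]_n).

Definition lastmx (R : realType) (L n : nat) : 'M[R]_(bdim L n, n) :=
  \mxcol_(i < L) (if i.+1 == L then 1%:M else 0 : 'M[R]_n).

Notation zdim L nu ny := (bdim L nu + bdim L ny)%N.
Notation edim L nx ny := (bdim L nx + bdim L ny)%N.
Notation hdim L nu nx ny := (zdim L nu ny + edim L nx ny)%N.

Section Predictor.
Variables (R : realType) (nx nu ny L : nat).
Variables (A : 'M[R]_nx) (B : 'M[R]_(nx, nu)) (C : 'M[R]_(ny, nx)).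

Definition M1 : 'M[R]_(nx, bdim L nu) :=
  reachmx L A B - A ^+ L *m mpinv (obsmx L A C) *m toepmx L A B C.

Definition M2 : 'M[R]_(nx, bdim L ny) := A ^+ L *m mpinv (obsmx L A C).

Definition M3 : 'M[R]_(nx, bdim L nx) :=
  reachmx L A 1%:M - A ^+ L *m mpinv (obsmx L A C) *m toepmx L A 1%:M C.

Definition M4 : 'M[R]_(nx, bdim L ny) := - (A ^+ L *m mpinv (obsmx L A C)).

Definition Mrow : 'M[R]_(nx, hdim L nu nx ny) :=
  row_mx (row_mx M1 M2) (row_mx M3 M4).

Definition Theta : 'M[R]_(hdim L nu nx ny) :=
  block_mx (block_mx (shiftmx R L nu) 0 0 (shiftmx R L ny)) 0
           0 (block_mx (shiftmx R L nx) 0 0 (shiftmx R L ny))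
  + col_mx (col_mx 0 (lastmx R L ny *m C *m Mrow)) (col_mx 0 0).

Definition Psi : 'M[R]_(ny, hdim L nu nx ny) := C *m Mrow.

End Predictor.

Definition Pi_d (R : realType) (nx nu ny L : nat) :
    'M[R]_(hdim L nu nx ny, nx + ny) :=
  col_mx (col_mx (row_mx 0 0) (row_mx 0 (lastmx R L ny)))
         (col_mx (row_mx (lastmx R L nx) 0) (row_mx 0 (lastmx R L ny))).

Definition Pi_u (R : realType) (nx nu ny L : nat) :
    'M[R]_(hdim L nu nx ny, nu) :=
  col_mx (col_mx (lastmx R L nu) 0) (col_mx 0 0).

Definition Gamma (R : realType) (nx nu ny L : nat) :
    'M[R]_(zdim L nu ny, hdim L nu nx ny) := row_mx 1%:M 0.

Definition Upsilon (R : realType) (nx ny : nat) : 'M[R]_(ny, nx + ny) :=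
  row_mx 0 1%:M.

Definition plant (R : realType) (nx nu ny : nat)
    (A : 'M[R]_nx) (B : 'M[R]_(nx, nu)) (C : 'M[R]_(ny, nx))
    (u : nat -> 'cV[R]_nu) (w : nat -> 'cV[R]_nx) (v : nat -> 'cV[R]_ny)
    (x : nat -> 'cV[R]_nx) (y : nat -> 'cV[R]_ny) : Prop :=
  [/\ x 0%N = 0,
      forall t, x t.+1 = A *m x t + B *m u t + w t
    & forall t, y t = C *m x t + v t].

(* Only the values of h, y and z at times t >= L are constrained. *)
Definition history_system (R : realType) (nx nu ny L : nat)
    (A : 'M[R]_nx) (B : 'M[R]_(nx, nu)) (C : 'M[R]_(ny, nx))
    (u : nat -> 'cV[R]_nu) (d : nat -> 'cV[R]_(nx + ny))
    (h : nat -> 'cV[R]_(hdim L nu nx ny)) (y : nat -> 'cV[R]_ny)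
    (z : nat -> 'cV[R]_(zdim L nu ny)) : Prop :=
  forall t, (L <= t)%N ->
    [/\ h t.+1 = Theta L A B C *m h t + Pi_d R nx nu ny L *m d t
                 + Pi_u R nx nu ny L *m u t,
        y t = Psi L A B C *m h t + Upsilon R nx ny *m d t
      & z t = Gamma R nx nu ny L *m h t].

(* Main.v *)
(** Observability makes [mpinv (obsmx L A C)] a left inverse of [obsmx L A C],
    so the state L steps before time t can be read off the window
    [t - L, t - 1] of inputs, outputs and disturbances; propagating it forward
    gives x(t) = Mrow * h(t) as soon as h(t) is the true history.  The
    block row of Theta for y then shifts the outputs and appends C x(t), and
    adding the new samples gives the true history at time t + 1. *)
Require Import Defs.
From mathcomp Require Import all_boot all_order all_algebra.
From mathcomp Require Import boolp classical_sets reals.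
From mathcomp Require Import ring.
Set Implicit Arguments.
Unset Strict Implicit.
Unset Printing Implicit Defensive.
Import Order.TTheory GRing.Theory Num.Theory.
Local Open Scope ring_scope.

Lemma mpinv_row_full (R : realType) (m n : nat) (X : 'M[R]_(m, n)) :
  row_full X -> mpinv X *m X = 1%:M.
Proof.
case/row_fullP=> Y YX; have [XK _ _ _] := mpinvP X.
by rewrite -[LHS]mul1mx -YX -mulmxA (mulmxA X) XK.
Qed.

Lemma mul_mxblock_mxcol (R : pzSemiRingType) (p q n : nat)
    (p_ : 'I_p -> nat) (q_ : 'I_q -> nat)
    (X : forall i j, 'M[R]_(p_ i, q_ j)) (Y : forall j, 'M[R]_(q_ j, n)) :
  \mxblock_(i, j) X i j *m \mxcol_j Y j = \mxcol_i (\sum_j X i j *m Y j).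
Proof.
rewrite mxblockEv mxcol_mul; apply: eq_mxcol => i.
by rewrite mul_mxrow_mxcol.
Qed.

Lemma stack_next (R : realType) (n L t : nat) (f : nat -> 'cV[R]_n) :
  shiftmx R L n *m stack f t L + lastmx R L n *m f (t + L)%N
  = stack f t.+1 L.
Proof.
rewrite /shiftmx /stack /lastmx mul_mxblock_mxcol mxcol_mul -mxcolD.
apply: eq_mxcol => i; rewrite addSnnS.
have [iL|iL] := eqVneq i.+1 L.
  rewrite mul1mx iL big1 ?add0r // => j _.
  by rewrite ltn_eqF ?ltn_ord // mul0mx.
have ltiL : (i.+1 < L)%N by rewrite ltn_neqAle iL ltn_ord.
rewrite mul0mx addr0 (bigD1 (Ordinal ltiL)) //= eqxx mul1mx big1 ?addr0 //.
by move=> j ji; rewrite ifN ?mul0mx.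
Qed.

Section Predictor.
Variables (R : realType) (nx ny : nat).
Implicit Types (A : 'M[R]_nx) (C : 'M[R]_(ny, nx)).

Lemma reachmx_stack m L A (B : 'M[R]_(nx, m)) (f : nat -> 'cV[R]_m) t :
  reachmx L A B *m stack f t L
  = \sum_(j < L) A ^+ (L - j.+1) *m B *m f (t + j)%N.
Proof. by rewrite mul_mxrow_mxcol. Qed.

Lemma reachmx_stackS m L A (B : 'M[R]_(nx, m)) (f : nat -> 'cV[R]_m) t :
  reachmx L.+1 A B *m stack f t L.+1
  = A *m (reachmx L A B *m stack f t L) + B *m f (t + L)%N.
Proof.
rewrite !reachmx_stack big_ord_recr /= subnn expr0 mul1mx; congr (_ + _).
rewrite mulmx_sumr; apply: eq_bigr => j _.
by rewrite subSn // exprS !mulmxA.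
Qed.

Lemma toepmx_stack m L A (B : 'M[R]_(nx, m)) C (f : nat -> 'cV[R]_m) t :
  toepmx L A B C *m stack f t L
  = \mxcol_(i < L) (C *m (reachmx i A B *m stack f t i)).
Proof.
rewrite mul_mxblock_mxcol; apply: eq_mxcol => i.
rewrite reachmx_stack mulmx_sumr.
rewrite (big_ord_widen L
  (fun j => C *m (A ^+ (i - j.+1) *m B *m f (t + j)%N))) 1?ltnW //.
rewrite [RHS]big_mkcond.
by apply: eq_bigr => j _; case: ifP => _; rewrite ?mul0mx // !mulmxA.
Qed.

Variables (nu : nat) (B : 'M[R]_(nx, nu)) (u : nat -> 'cV[R]_nu).
Variables (w : nat -> 'cV[R]_nx) (v : nat -> 'cV[R]_ny).
Variables (x : nat -> 'cV[R]_nx) (y : nat -> 'cV[R]_ny).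

Definition history L t : 'cV[R]_(hdim L nu nx ny) :=
  col_mx (col_mx (stack u t L) (stack y t L))
         (col_mx (stack w t L) (stack v t L)).

Lemma plant_state A C t k : plant A B C u w v x y ->
  x (t + k)%N = A ^+ k *m x t + reachmx k A B *m stack u t k
                + reachmx k A 1%:M *m stack w t k.
Proof.
case=> _ xS _; elim: k => [|k IHk].
  by rewrite addn0 expr0 mul1mx !reachmx_stack !big_ord0 !addr0.
rewrite addnS xS IHk !reachmx_stackS exprS !mulmxDr mul1mx -!mulmxA.
move: (A *m (A ^+ k *m x t)) (A *m (_ *m stack u t k)) (B *m u _) => a b c.
by rewrite -!addrA; do 2!congr (_ + _); rewrite addrCA.
Qed.

Lemma plant_output_stack A C t L : plant A B C u w v x y ->
  stack y t L = obsmx L A C *m x t + toepmx L A B C *m stack u t L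
                + toepmx L A 1%:M C *m stack w t L + stack v t L.
Proof.
move=> P; have [_ _ yE] := P.
rewrite !toepmx_stack mxcol_mul -!mxcolD; apply: eq_mxcol => i.
by rewrite yE (plant_state _ _ P) !mulmxDr mulmxA.
Qed.

Lemma Mrow_history A C t L : \rank (obsmx L A C) = nx ->
  plant A B C u w v x y -> Mrow L A B C *m history L t = x (t + L)%N.
Proof.
move=> /eqP fullO P; rewrite !mul_row_col (plant_output_stack _ _ P).
rewrite /M1 /M2 /M3 /M4 !mulmxDl !mulmxDr !mulNmx (plant_state _ _ P).
have -> : A ^+ L *m mpinv (obsmx L A C) *m (obsmx L A C *m x t)
          = A ^+ L *m x t.
  by rewrite mulmxA -(mulmxA (A ^+ L)) mpinv_row_full // mulmx1.
rewrite !mulmxA.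
move: (A ^+ L *m x t) (reachmx L A B *m _) (reachmx L A 1%:M *m _) => a b c.
move: (_ *m toepmx L A B C *m _) (_ *m toepmx L A 1%:M C *m _) => p q.
move: (_ *m stack v t L) => r.
by apply/matrixP => i j; rewrite !mxE; ring.
Qed.

Lemma history_next A C t L : \rank (obsmx L A C) = nx ->
  plant A B C u w v x y ->
  history L t.+1 = Theta L A B C *m history L t
    + Pi_d R nx nu ny L *m col_mx (w (t + L)%N) (v (t + L)%N)
    + Pi_u R nx nu ny L *m u (t + L)%N.
Proof.
move=> rO P; have [_ _ yE] := P.
rewrite /Theta mulmxDl !mul_col_mx -!mulmxA (Mrow_history _ rO P).
rewrite /history !mul_row_col !mul_block_col !mul0mx !add_col_mx.
rewrite !(addr0, add0r, add_col_mx).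
by rewrite -addrA -mulmxDr -yE -!stack_next.
Qed.

End Predictor.

Theorem lemma1 (R : realType) (nx nu ny L : nat)
    (A : 'M[R]_nx) (B : 'M[R]_(nx, nu)) (C : 'M[R]_(ny, nx))
    (hobs : \rank (obsmx L A C) = nx)
    (u : nat -> 'cV[R]_nu) (w : nat -> 'cV[R]_nx) (v : nat -> 'cV[R]_ny)
    (x : nat -> 'cV[R]_nx) (y : nat -> 'cV[R]_ny)
    (h : nat -> 'cV[R]_(hdim L nu nx ny)) (yS : nat -> 'cV[R]_ny)
    (zS : nat -> 'cV[R]_(zdim L nu ny)) :
  plant A B C u w v x y ->
  history_system A B C u (fun t => col_mx (w t) (v t)) h yS zS ->
  h L = col_mx (col_mx (stack u 0 L) (stack y 0 L))
               (col_mx (stack w 0 L) (stack v 0 L)) ->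
  forall t : nat, (L <= t)%N -> y t = yS t.
Proof.
move=> P S hL t leLt.
have hE s : h (s + L)%N = history u w v y L s.
  elim: s => [|s IHs]; first exact: hL.
  have [hS _ _] := S _ (leq_addl s L).
  by rewrite addSn hS IHs (history_next s hobs P).
have [_ -> _] := S _ leLt; have [_ _ ->] := P.
rewrite -(subnK leLt) hE /Psi -mulmxA (Mrow_history _ hobs P).
by rewrite mul_row_col mul0mx mul1mx add0r.
Qed.
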